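(* Let $R$ be a ring. \begin{enumerate} \item A module $E$ is injective if and only if for every embedding $f: A \to B$ with $\|A\|, \|B\| \leq \operatorname{card}(R) + \aleph_0$ and every $R$-homomorphism $g: A \to E$ there is an $R$-homomorphism $h: B \to E$ such that $h \circ f = g$. \item A module $E$ is $RD$-injective if and only if for every $RD$-embedding $f: A \to B$ with $\|A\|, \|B\| \leq \operatorname{card}(R) + \aleph_0$ and every $R$-homomorphism $g: A \to E$ there is an $R$-homomorphism $h: B \to E$ such that $h \circ f = g$. \item A module $E$ is pure injective if and only if for every pure embedding $f: A \to B$ with $\|A\|, \|B\| \leq \operatorname{card}(R) + \aleph_0$ and every $R$-homomorphism $g: A \to E$ there is an $R$-homomorphism $h: B \to E$ such that $h \circ f = g$. \item Let $F$ be a flat module. Then $F$ is cotorsion if and only if for every pure embedding $f: A \to B$ with $A, B$ flat and $\|A\|, \|B\| \leq \operatorname{card}(R) + \aleph_0$ and every $R$-homomorphism $g: A \to F$ there is an $R$-homomorphism $h: B \to F$ such that $h \circ f = g$. \item Let $T$ be an $\mathfrak{s}$-torsion module. Then $T$ is $K^{\mathfrak{s}\text{-Tor}}$-pure injective if and only if for every pure embedding $f: A \to B$ with $A, B$ $\mathfrak{s}$-torsion modules and $\|A\|, \|B\| \leq \operatorname{card}(R) + \aleph_0$ and every $R$-homomorphism $g: A \to T$ there is an $R$-homomorphism $h: B \to T$ such that $h \circ f = g$. \end{enumerate}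
   Context: Rings are associative with unity; modules are left $R$-modules; $\|A\|$ is the cardinality of $A$. Pure embeddings are meant in the usual sense. An embedding $f: A \to B$ is an $RD$-embedding if $f[A] \cap rB = r f[A]$ for every $r \in R$. A module $E$ is $RD$-injective (resp. pure injective) if for every $RD$-embedding (resp. pure embedding) $f: A \to B$ of modules and every homomorphism $g: A \to E$ there is $h: B \to E$ with $h \circ f = g$. A module $C$ is cotorsion if $\operatorname{Ext}^1_R(F, C) = 0$ for every flat module $F$. For a left $R$-module $M$, $\mathfrak{s}(M)$ is the kernel of the map $M \cong R \otimes_R M \to E(R_R) \otimes_R M$ induced by the inclusion of $R$ as a right module into its injective envelope $E(R_R)$; $M$ is $\mathfrak{s}$-torsion if $\mathfrak{s}(M) = M$. An $\mathfrak{s}$-torsion module $T$ is $K^{\mathfrak{s}\text{-Tor}}$-pure injective if for every pure embedding $f: A \to B$ with $A, B$ $\mathfrak{s}$-torsion modules and every homomorphism $g: A \to T$ there is $h: B \to T$ with $h \circ f = g$. *)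

(* Defs.v *)
From HB Require Import structures.
From mathcomp Require Import all_boot all_order all_algebra ring_quotient.
From mathcomp.multinomials Require Import freeg.
From mathcomp Require Import boolp classical_sets functions cardinality.

Set Implicit Arguments.
Unset Strict Implicit.
Unset Printing Implicit Defensive.

Import GRing.Theory.

Local Open Scope classical_set_scope.
Local Open Scope card_scope.
Local Open Scope ring_scope.

(* Left R-modules are [lmodType R]; right R-modules are left modules over the
   converse ring, [lmodType R^c], so that [(r : R^c) *: n] is n.r.  Rings are
   [pzRingType]s: the zero ring is allowed. *)

(* The subgroup of the free abelian group on N * M by which N (x)_R M is the
   quotient. *)
Inductive tensor_relation (R : pzRingType) (N : lmodType R^c) (M : lmodType R) :
    {freeg (N * M)%type / int} -> Prop :=
| TRaddl (n n' : N) (m : M) :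
    tensor_relation (<< (n + n', m) >> - << (n, m) >> - << (n', m) >>)
| TRaddr (n : N) (m m' : M) :
    tensor_relation (<< (n, m + m') >> - << (n, m) >> - << (n, m') >>)
| TRscale (n : N) (r : R) (m : M) :
    tensor_relation (<< ((r : R^c) *: n, m) >> - << (n, r *: m) >>)
| TR0 : tensor_relation 0
| TRsub x y : tensor_relation x -> tensor_relation y -> tensor_relation (x - y).

Definition tensor_pred (R : pzRingType) (N : lmodType R^c) (M : lmodType R) :
    {freeg (N * M)%type / int} -> bool :=
  fun x => `[< tensor_relation x >].

Lemma tensor_pred_closed (R : pzRingType) (N : lmodType R^c) (M : lmodType R) :
  zmod_closed (@tensor_pred R N M).
Proof.
split; first by apply/asboolP; exact: TR0.
by move=> x y /asboolP xI /asboolP yI; apply/asboolP; exact: TRsub.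
Qed.

HB.instance Definition _ (R : pzRingType) (N : lmodType R^c) (M : lmodType R) :=
  GRing.isZmodClosed.Build {freeg (N * M)%type / int} (@tensor_pred R N M)
    (@tensor_pred_closed R N M).

Definition tensor (R : pzRingType) (N : lmodType R^c) (M : lmodType R) :
    zmodType :=
  Quotient.quot (GRing.ZmodClosed.clone _ (@tensor_pred R N M) _).

Definition tens (R : pzRingType) (N : lmodType R^c) (M : lmodType R)
    (n : N) (m : M) : tensor N M :=
  (\pi << (n, m) >>)%qT.

Definition tensor_map (R : pzRingType) (N N' : lmodType R^c) (M : lmodType R)
    (f : {linear N -> N'}) (t : tensor N M) : tensor N' M :=
  fglift (fun nm : N * M => tens (f nm.1) nm.2 : zmodule (tensor N' M)) (repr t).

Section TensorTheory.
Variables (R : pzRingType).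
Implicit Types (N : lmodType R^c) (M : lmodType R).

Lemma tensor_eqP N M (x y : {freeg (N * M)%type / int}) :
  reflect (tensor_relation (x - y))
          ((\pi x : tensor N M) == \pi y)%qT.
Proof.
have <- : (x - y \in @tensor_pred R N M) =
          ((\pi x : tensor N M) == \pi y)%qT by rewrite Quotient.idealrBE.
exact: asboolP.
Qed.

Lemma tensDl N M (n n' : N) (m : M) : tens (n + n') m = tens n m + tens n' m.
Proof.
apply/eqP; rewrite /tens -raddfD /=; apply/tensor_eqP.
by rewrite opprD addrA; exact: TRaddl.
Qed.

Lemma tensDr N M (n : N) (m m' : M) : tens n (m + m') = tens n m + tens n m'.
Proof.
apply/eqP; rewrite /tens -raddfD /=; apply/tensor_eqP.
by rewrite opprD addrA; exact: TRaddr.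
Qed.

Lemma tensZ N M (n : N) (r : R) (m : M) :
  tens ((r : R^c) *: n) m = tens n (r *: m).
Proof. by apply/eqP/tensor_eqP; exact: TRscale. Qed.

Section Map.
Variables (N N' : lmodType R^c) (M : lmodType R) (f : {linear N -> N'}).

Let F : {freeg (N * M)%type / int} ->
    zmodule (tensor N' M) :=
  fglift (fun nm : N * M => tens (f nm.1) nm.2 : zmodule (tensor N' M)).

Let FB : {morph F : x y / x - y}. Proof. exact: lift_is_additive. Qed.

Let FU n m : F << (n, m) >> = tens (f n) m.
Proof. by rewrite /F liftU scale1r. Qed.

Lemma tensor_map_pi x : tensor_map f (\pi x : tensor N M)%qT = F x.
Proof.
rewrite /tensor_map -/F; apply/eqP; rewrite -subr_eq0 -FB; apply/eqP.
have : tensor_relation (repr (\pi x : tensor N M)%qT - x).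
  by apply/tensor_eqP; rewrite reprK.
elim=> [n n' m|n m m'|n r m||y z _ Fy _ Fz].
- by rewrite !FB !FU linearD tensDl -addrA -opprD subrr.
- by rewrite !FB !FU tensDr -addrA -opprD subrr.
- by rewrite FB !FU linearZ /= tensZ subrr.
- by have := FB 0 0; rewrite !subrr.
- by rewrite FB Fy Fz subrr.
Qed.

Lemma tensor_map_tens (n : N) (m : M) : tensor_map f (tens n m) = tens (f n) m.
Proof. by rewrite /tens tensor_map_pi FU. Qed.

Lemma tensor_map_is_zmod_morphism :
  zmod_morphism (tensor_map f : tensor N M -> tensor N' M).
Proof.
move=> s t; rewrite -[s]reprK -[t]reprK -raddfB /= !tensor_map_pi.
exact: FB.
Qed.

HB.instance Definition _ :=
  GRing.isZmodMorphism.Build (tensor N M) (tensor N' M) (tensor_map f)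
    tensor_map_is_zmod_morphism.

End Map.
End TensorTheory.

Definition flat (R : pzRingType) (F : lmodType R) : Prop :=
  forall (N N' : lmodType R^c) (f : {linear N -> N'}),
    injective f -> injective (tensor_map f : tensor N F -> tensor N' F).

(* A finite system of linear equations with constants in f(A) that is solvable
   in B is solvable in A; equivalently f(A) is closed in B under the truth of
   positive primitive formulas. *)
Definition pure_embedding (R : pzRingType) (A B : lmodType R)
    (f : {linear A -> B}) : Prop :=
  injective f /\
  forall (m n : nat) (r : 'M[R]_(m, n)) (a : 'I_m -> A),
    (exists y : 'I_n -> B, forall i, \sum_(j < n) r i j *: y j = f (a i)) ->
    exists x : 'I_n -> A, forall i, \sum_(j < n) r i j *: x j = a i.

Definition RD_embedding (R : pzRingType) (A B : lmodType R)
    (f : {linear A -> B}) : Prop :=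
  injective f /\
  forall r : R, range f `&` range (fun b : B => r *: b) =
                [set r *: b | b in range f].

Definition extends_along (R : pzRingType) (A B E : lmodType R)
    (f : {linear A -> B}) : Prop :=
  forall g : {linear A -> E}, exists h : {linear B -> E}, h \o f =1 g.

Definition injective_module (R : pzRingType) (E : lmodType R) : Prop :=
  forall (A B : lmodType R) (f : {linear A -> B}),
    injective f -> extends_along E f.

Definition RD_injective (R : pzRingType) (E : lmodType R) : Prop :=
  forall (A B : lmodType R) (f : {linear A -> B}),
    RD_embedding f -> extends_along E f.

Definition pure_injective (R : pzRingType) (E : lmodType R) : Prop :=
  forall (A B : lmodType R) (f : {linear A -> B}),
    pure_embedding f -> extends_along E f.

(* Ext^1_R(F, C) is taken as the set of congruence classes of extensions
   0 -> C -> X -> F -> 0, whose zero is the class of C (+) F. *)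
Record extension (R : pzRingType) (F C : lmodType R) := Extension {
  ext_mid : lmodType R;
  ext_in : {linear C -> ext_mid};
  ext_out : {linear ext_mid -> F};
  ext_in_inj : injective ext_in;
  ext_exact : range ext_in = [set x | ext_out x = 0];
  ext_out_surj : range ext_out = setT
}.

Definition ext_congruent (R : pzRingType) (F C : lmodType R)
    (X Y : extension F C) : Prop :=
  exists phi : {linear ext_mid X -> ext_mid Y},
    phi \o ext_in X =1 ext_in Y /\ ext_out Y \o phi =1 ext_out X.

Section SplitExtension.
Variables (R : pzRingType) (F C : lmodType R).

Definition split_in (c : C) : (C * F)%type := (c, 0).

Lemma split_in_is_linear : linear split_in.
Proof. by move=> k c c'; congr pair; rewrite /= scaler0 addr0. Qed.

HB.instance Definition _ :=
  GRing.isLinear.Build R C (C * F)%type *:%R split_in split_in_is_linear.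

Lemma split_in_inj : injective split_in. Proof. by move=> c c' []. Qed.

Lemma split_exact : range split_in = [set x | x.2 = 0].
Proof.
apply/seteqP; split=> [_ [c _ <-] //|[c y] /= ->].
by exists c.
Qed.

Lemma split_out_surj : range (@snd C F) = setT.
Proof. by apply/seteqP; split=> // y _; exists (0, y). Qed.

Definition split_extension : extension F C :=
  @Extension R F C (C * F)%type split_in (@snd C F)
    split_in_inj split_exact split_out_surj.

End SplitExtension.

Definition Ext1_eq0 (R : pzRingType) (F C : lmodType R) : Prop :=
  forall X : extension F C, ext_congruent X (split_extension F C).

Definition cotorsion (R : pzRingType) (C : lmodType R) : Prop :=
  forall F : lmodType R, flat F -> Ext1_eq0 F C.

(* The last clause is essentiality: every nonzero submodule of E meets i(M)
   nontrivially. *)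
Definition injective_envelope (R : pzRingType) (M E : lmodType R)
    (i : {linear M -> E}) : Prop :=
  [/\ injective i, injective_module E &
      forall S : {pred E}, submod_closed S -> (exists2 x, x \in S & x != 0) ->
        exists2 m, i m \in S & i m != 0].

Definition regular_right (R : pzRingType) : lmodType R^c := (R^c)^o.

(* M -> R (x)_R M, m |-> 1 (x) m, followed by i (x) M. *)
Definition s_radical (R : pzRingType) (ER : lmodType R^c)
    (i : {linear regular_right R -> ER}) (M : lmodType R) : set M :=
  [set m : M | tensor_map i (tens (N := regular_right R) (1 : R^c) m) = 0].

Arguments s_radical [R ER] i M.

Definition s_torsion (R : pzRingType) (ER : lmodType R^c)
    (i : {linear regular_right R -> ER}) (M : lmodType R) : Prop :=
  s_radical i M = setT.

Definition s_torsion_pure_injective (R : pzRingType) (ER : lmodType R^c)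
    (i : {linear regular_right R -> ER}) (T : lmodType R) : Prop :=
  forall (A B : lmodType R) (f : {linear A -> B}),
    s_torsion i A -> s_torsion i B -> pure_embedding f -> extends_along T f.

(* The disjoint sum R + nat has cardinality card(R) + aleph_0. *)
Definition small_module (R : pzRingType) (A : lmodType R) : Prop :=
  [set: A] #<= [set: (R + nat)%type].

(* Main.v *)
From HB Require Import structures.
Require Import Defs.
From mathcomp Require Import all_boot all_order all_algebra ring_quotient.
From mathcomp.multinomials Require Import freeg.
From mathcomp Require Import boolp classical_sets functions cardinality.

(** Given a pure embedding f : A -> B and g : A -> E, the submodules of B * E that
    are graphs of maps extending g, with a domain D pure in B, have a maximal
    member.  If some b lay outside D, a Loewenheim-Skolem argument would give a
    submodule S of B of cardinality at most card R + aleph_0 that contains b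
    and is closed under solving linear systems in B, in D, and modulo D
    ([hull]).  Then S is pure in B, the intersection of S and D is pure in S,
    and D + S is pure in B.  The hypothesis on small embeddings extends the
    partial map from that intersection to S, and the two maps glue to a larger
    partial extension on D + S ([amalgamP]), contradicting maximality.

    All five equivalences are instances of this argument
    ([extends_along_from_small]), because it works for purity relative to any
    class of matrices: no matrix gives all embeddings, the 1 x 1 matrices give
    RD-embeddings, and all matrices give pure embeddings.  It also stays inside
    any class of modules closed under pure submodules, such as the flat
    and the s-torsion modules.

    The bound on S comes from writing its elements as values of finite trees
    labelled by linear systems over R ([skolem_hull]).  Such trees are finite
    sequences in R + nat, and the square of an infinite set K embeds in K
    ([embeds_square]), hence so do the finite sequences in K ([embeds_seq]).

    Flatness and s-torsion are defined by tensor products.  If a sum of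
    elementary tensors n (x) m vanishes, then finitely many linear relations
    among elements of M account for it ([tens_sum_eq0]).  Moving these
    finitely many relations along a flat factorization, or along a pure
    embedding, gives the equational criterion for flatness ([flatP]) and the
    inheritance of s-torsion ([s_torsion_pure_sub]).

    For flat F, being cotorsion is the same as extending along pure embeddings
    A -> B with B flat.  The cokernel of such an embedding is flat, so
    that its pushout along A -> F is an extension that splits
    ([cotorsion_extends]).  Conversely, in an extension of a flat module by F
    the middle module is flat and F is pure in it, so that the identity of F
    extends to a retraction ([cotorsion_from_extends]). *)

Set Implicit Arguments.
Unset Strict Implicit.
Unset Printing Implicit Defensive.

Import GRing.Theory.

Local Open Scope classical_set_scope.
Local Open Scope card_scope.
Local Open Scope ring_scope.

(** * Maximal sets and comparison of cardinals *)

Definition embeds (T U : Type) : Prop := exists f : T -> U, injective f.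

Lemma embeds_card (T U : Type) : embeds T U <-> [set: T] #<= [set: U].
Proof.
split=> [[f f_inj]|/card_leP [f]].
  have fT : f @` setT #= [set: T] by apply: inj_card_eq => x y _ _; exact: f_inj.
  by rewrite -(card_le_eql fT); exact: card_leT.
pose to T' (x : T') : [set: T'] := SigSub (mem_set (I : [set: T'] x)).
exists (fun x => val (f (to T x))) => x y /val_inj e.
have := @inj _ _ _ f (to T x) (to T y) (in_setT _) (in_setT _) e.
by move=> [].
Qed.

Lemma embeds_trans (T U V : Type) : embeds T U -> embeds U V -> embeds T V.
Proof. by move=> [f fI] [g gI]; exists (g \o f); exact: inj_comp. Qed.

(** Since only nonempty chains are considered, [P] may require its members to
    contain a given set, a condition that the empty union would violate. *)
Lemma Zorn_subset (T : Type) (P : set (set T)) (G0 : set T) : P G0 ->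
    (forall F : set (set T), F !=set0 -> F `<=` P -> total_on F subset ->
      P (\bigcup_(X in F) X)) ->
  exists2 G, P G & forall H, P H -> G `<=` H -> H `<=` G.
Proof.
move=> PG0 Pchain.
have [|G [PG Gmax]] := @Zorn_bigcup T (fun X => X = set0 \/ P X).
  move=> F FP Ftot; pose F' := F `&` P.
  have FF' : \bigcup_(X in F) X = \bigcup_(X in F') X.
    apply/seteqP; split=> x [X FX Xx]; last by exists X => //; case: FX.
    by exists X => //; split=> //; case: (FP _ FX) => // X0; rewrite X0 in Xx.
  have [F'0|/eqP/negP/negP/set0P F'n] := pselect (F' = set0).
    by left; rewrite FF' F'0 bigcup_set0.
  right; rewrite FF'; apply: Pchain => // [X [] //|X Y [FX _] [FY _]].
  exact: Ftot.
have {PG}PG : P G.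
  case: PG => // G_0; case: (pselect (G0 `<=` set0)) => G00.
    by rewrite G_0; move: G00; rewrite subset0 => <-.
  by exfalso; apply: (Gmax G0); [rewrite G_0; split|right].
exists G => // H PH GH; apply: contrapT => HG.
by apply: (Gmax H); [split|right].
Qed.

Lemma total_on_cover2 (T : Type) (F : set (set T)) (x y : T) :
    total_on F subset -> (\bigcup_(X in F) X) x -> (\bigcup_(X in F) X) y ->
  exists X, [/\ F X, X x & X y].
Proof.
move=> Ftot [X FX Xx] [Y FY Yy].
by have [XY|YX] := Ftot _ _ FX FY; [exists Y|exists X]; split=> //;
  [exact: XY|exact: YX].
Qed.

(** A maximal partial injection between [A] and [B], seen as a set of pairs,
    is defined on all of [A] or reaches all of [B]: otherwise one more pair
    could be added. *)
Lemma injections_total (T U : Type) (A : set T) (B : set U) (a : T) (b : U) :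
  (exists f : T -> U, (forall x, A x -> B (f x)) /\
     forall x y, A x -> A y -> f x = f y -> x = y) \/
  (exists g : U -> T, (forall x, B x -> A (g x)) /\
     forall x y, B x -> B y -> g x = g y -> x = y).
Proof.
pose P (G : set (T * U)) :=
  (forall p, G p -> A p.1 /\ B p.2) /\
  forall p q, G p -> G q -> (p.1 = q.1 <-> p.2 = q.2).
have [| |G [Gsub Ginj] Gmax] := @Zorn_subset _ P set0.
- by split=> // p [].
- move=> F _ FP Ftot; split=> [p [X FX Xp]|p q Up Uq].
    exact: (FP _ FX).1.
  have [X [FX Xp Xq]] := total_on_cover2 Ftot Up Uq.
  exact: (FP _ FX).2.
have [Atot|/existsNP [x /not_implyP [Ax nx]]] :=
    pselect (forall x, A x -> exists y, G (x, y)).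
  left; have /choice [f fG] : forall x, exists y, A x -> G (x, y).
    move=> x; have [Ax|?] := pselect (A x); last by exists b.
    by have [y] := Atot _ Ax; exists y.
  exists f; split=> [x /fG /Gsub [] //|x y /fG Gx /fG Gy fxy].
  exact: (Ginj _ _ Gx Gy).2.
have [Btot|/existsNP [y /not_implyP [By ny]]] :=
    pselect (forall y, B y -> exists x, G (x, y)).
  right; have /choice [g gG] : forall y, exists x, B y -> G (x, y).
    move=> y; have [By|?] := pselect (B y); last by exists a.
    by have [x'] := Btot _ By; exists x'.
  exists g; split=> [y /gG /Gsub [] //|y z /gG Gy /gG Gz gyz].
  exact: (Ginj _ _ Gy Gz).1.
exfalso; apply: (nx); exists y.
apply: (Gmax (G `|` [set (x, y)])); [|by left|by right].
split=> [p [/Gsub //|-> //]|p q [Gp|->] [Gq|->] //=]; first exact: Ginj.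
- split=> e; exfalso; [apply: nx; exists p.2|apply: ny; exists p.1].
    by rewrite -e -surjective_pairing.
  by rewrite -e -surjective_pairing.
- split=> e; exfalso; [apply: nx; exists q.2|apply: ny; exists q.1].
    by rewrite e -surjective_pairing.
  by rewrite e -surjective_pairing.
Qed.

(** * Squares of infinite sets *)

Section Square.
Variables (K : Type) (nu : nat -> K).
Hypothesis nuI : injective nu.

Definition carrier (G : set (K * K * K)) : set K :=
  [set u | exists v w, G (u, v, w)].

(** [G] is the graph of an injection of [carrier G * carrier G] into
    [carrier G], where the carrier contains the range of [nu]. *)
Definition square_injection (G : set (K * K * K)) : Prop :=
  [/\ forall n, carrier G (nu n),
      forall u v w, G (u, v, w) -> carrier G v /\ carrier G w,
      forall u v, carrier G u -> carrier G v -> exists w, G (u, v, w) &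
      forall p q, G p -> G q -> (p.1 = q.1 <-> p.2 = q.2)].

Definition nat_square_injection : set (K * K * K) :=
  [set (nu ij.1, nu ij.2, nu (pickle ij)) | ij in [set: nat * nat]].

Lemma nat_square_injectionP : square_injection nat_square_injection.
Proof.
have carE u : carrier nat_square_injection u <-> exists i, u = nu i.
  split=> [[v [w [ij _ [<- _ _]]]]|[i ->]]; first by exists ij.1.
  by exists (nu 0%N), (nu (pickle (i, 0%N))), (i, 0%N).
split.
- by move=> n; apply/carE; exists n.
- by move=> u v w [ij _ [_ <- <-]]; split; apply/carE; [exists ij.2|eexists].
- move=> _ _ /carE [i ->] /carE [j ->].
  by exists (nu (pickle (i, j))), (i, j).
- move=> _ _ [[i j] _ <-] [[k l] _ <-] /=.
  split; first by case=> /nuI -> /nuI ->.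
  by move=> /nuI /(pcan_inj pickleK) [-> ->].
Qed.

Lemma square_injection_bigcup (F : set (set (K * K * K))) :
  F !=set0 -> F `<=` square_injection -> total_on F subset ->
  square_injection (\bigcup_(X in F) X).
Proof.
move=> [X0 FX0] FP Ftot.
have carS X u : F X -> carrier X u -> carrier (\bigcup_(X in F) X) u.
  by move=> FX [v [w Xw]]; exists v, w, X.
split.
- by move=> n; apply: (carS X0) => //; case: (FP _ FX0).
- move=> u v w [X FX /=]; have [_ XP _ _] := FP _ FX.
  by move=> /XP [? ?]; split; exact: (carS X).
- move=> u v [u' [u'' Uu]] [v' [v'' Uv]].
  have [X [FX Xu Xv]] := total_on_cover2 Ftot Uu Uv.
  have [_ _ XP _] := FP _ FX; have [||w Xw] := XP u v.
  + by exists u', u''.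
  + by exists v', v''.
  by exists w, X.
- move=> p q Up Uq; have [X [FX Xp Xq]] := total_on_cover2 Ftot Up Uq.
  by have [_ _ _] := FP _ FX; apply.
Qed.

(** Let D carry a maximal injection phi : D * D -> D.  If the complement of D
    embeds in D, then so does K, and K * K embeds in D * D.  Otherwise D has a
    disjoint copy in its complement, and phi extends to the union of D and this
    copy, because the new pairs fit in the copy. *)
Theorem embeds_square : embeds (K * K) K.
Proof.
have [G [Gnu Gcar Gtot Ginj] Gmax] :=
  Zorn_subset nat_square_injectionP square_injection_bigcup.
pose D := carrier G; pose k0 := nu 0%N.
have /choice [phi' phiG] : forall p : K * K, exists w,
    D p.1 -> D p.2 -> G (p, w).
  move=> [u v]; have [[Du Dv]|nD] := pselect (D u /\ D v); last first.
    by exists k0 => Du Dv; case: nD.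
  by have [w] := Gtot _ _ Du Dv; exists w.
pose phi u v := phi' (u, v).
have phiD u v : D u -> D v -> D (phi u v).
  by move=> Du Dv; have /Gcar [] := phiG (u, v) Du Dv.
have phiI u v u' v' : D u -> D v -> D u' -> D v' ->
    phi u v = phi u' v' -> u = u' /\ v = v'.
  move=> Du Dv Du' Dv' e.
  by have [_ /(_ e) []] := Ginj _ _ (phiG (u, v) Du Dv) (phiG (u', v') Du' Dv').
have [[j [jD jI]]|[psi [psiD psiI]]] := injections_total (~` D) D k0 k0.
  (* [nu 0] and [nu 1] tag the two pieces of [K]. *)
  pose e u := if pselect (D u) then phi (nu 0%N) u else phi (nu 1%N) (j u).
  have eD u : D (e u).
    by rewrite /e; case: pselect => Du; apply: phiD => //;
      solve [exact: Gnu|exact: jD].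
  have eI : injective e.
    move=> u v; rewrite /e; case: pselect => Du; case: pselect => Dv E.
    - by have [] := phiI _ _ _ _ (Gnu _) Du (Gnu _) Dv E.
    - by have [/nuI] := phiI _ _ _ _ (Gnu _) Du (Gnu _) (jD _ Dv) E.
    - by have [/nuI] := phiI _ _ _ _ (Gnu _) (jD _ Du) (Gnu _) Dv E.
    - have [_] := phiI _ _ _ _ (Gnu _) (jD _ Du) (Gnu _) (jD _ Dv) E.
      exact: jI.
  exists (fun p => phi (e p.1) (e p.2)) => -[u v] [u' v'] /=.
  by move=> /phiI [] // /eI -> /eI ->.
exfalso.
(* The elements of the enlarged carrier are [E t x] with [x] in [D]; the copy is
   [E true].  A pair meeting the copy is sent into the copy, after its two
   tags have been coded by an element of [D]. *)
pose E (t : bool) x := if t then psi x else x.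
have EI s t x y : D x -> D y -> E s x = E t y -> s = t /\ x = y.
  move=> Dx Dy; case: s t => -[] //=.
  - by move=> /psiI ->.
  - by move=> e; case: (psiD _ Dx); rewrite e.
  - by move=> e; case: (psiD _ Dy); rewrite -e.
pose val s t x y := if s || t then psi (phi (nu (pickle (s, t))) (phi x y))
  else phi x y.
have valI s t x y s' t' x' y' : D x -> D y -> D x' -> D y' ->
    val s t x y = val s' t' x' y' -> [/\ s = s', t = t', x = x' & y = y'].
  move=> Dx Dy Dx' Dy'; rewrite /val.
  have stD b : D (phi (nu b) (phi x y)).
    by apply: (phiD); [exact: Gnu|exact: phiD].
  have stD' b : D (phi (nu b) (phi x' y')).
    by apply: (phiD); [exact: Gnu|exact: phiD].
  case: ifP => st; case: ifP => st'.
  - move=> /(psiI _ _ (stD _) (stD' _)) e.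
    have [] := phiI _ _ _ _ (Gnu _) (phiD _ _ Dx Dy) (Gnu _) (phiD _ _ Dx' Dy') e.
    move=> /nuI /(pcan_inj pickleK) [-> ->] {}e.
    by have [] := phiI _ _ _ _ Dx Dy Dx' Dy' e.
  - by move=> e; case: (psiD _ (stD (pickle (s, t)))); rewrite e; exact: phiD.
  - by move=> e; case: (psiD _ (stD' (pickle (s', t')))); rewrite -e; exact: phiD.
  - move: st st'; case: s t s' t' => -[] // [] [] // _ _.
    by move=> e; have [] := phiI _ _ _ _ Dx Dy Dx' Dy' e.
pose H : set (K * K * K) := [set p | exists s t x y,
  [/\ D x, D y & p = (E s x, E t y, val s t x y)]].
have HD s x : D x -> carrier H (E s x).
  by move=> Dx; exists (E s x), (val s s x x), s, s, x, x.
have carH u : carrier H u -> exists s x, D x /\ u = E s x.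
  by move=> [v [w [s [t [x [y [Dx Dy [-> _ _]]]]]]]]; exists s, x.
have HP : square_injection H.
  split.
  - by move=> n; apply: (HD false (nu n)); exact: Gnu.
  - move=> _ _ _ [s [t [x [y [Dx Dy [_ -> ->]]]]]]; split; first exact: HD.
    rewrite /val; case: ifP => _.
      by apply: (HD true); apply: (phiD); [exact: Gnu|exact: phiD].
    by apply: (HD false); exact: phiD.
  - move=> _ _ /carH [s [x [Dx ->]]] /carH [t [y [Dy ->]]].
    by exists (val s t x y), s, t, x, y.
  - move=> _ _ [s [t [x [y [Dx Dy ->]]]]] [s' [t' [x' [y' [Dx' Dy' ->]]]]] /=.
    split=> [[]|/valI [] // -> -> -> -> //].
    by move=> /EI [] // -> -> /EI [] // -> ->.
have GH : G `<=` H.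
  move=> [[u v] w] Guv; exists false, false, u, v.
  have Du : D u by exists v, w.
  have [Dv _] := Gcar _ _ _ Guv; split=> //; congr pair.
  exact: (Ginj _ _ Guv (phiG (u, v) Du Dv)).1.
have [v [w /(Gmax _ HP GH) Gvw]] := HD true k0 (Gnu 0%N).
by apply: (psiD k0); [exact: Gnu|exists v, w].
Qed.

(** Once the length is known, a sequence is recovered from the iterated pairing
    of its entries. *)
Theorem embeds_seq : embeds (seq K) K.
Proof.
have [p pI] := embeds_square.
pose code := foldr (fun x c => p (x, c)) (nu 0%N).
have codeI s t : size s = size t -> code s = code t -> s = t.
  elim: s t => [|x s IHs] [|y t] //= [] st /pI [-> /IHs -> //].
exists (fun s => p (nu (size s), code s)) => s t /pI [/nuI st]; exact: codeI.
Qed.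
End Square.

(** * Skolem hulls *)

Section SkolemHull.
Variables (K I : Type) (B : choiceType) (nu : nat -> K) (b0 : B).
Hypotheses (nuI : injective nu) (IK : embeds (nat + I) K).
Variable C : I -> seq B -> seq B -> Prop.

(** Downward Loewenheim-Skolem: fix a solution of every solvable problem
    [C i s].  The hull is the set of values of the finite trees in which a node
    with number [k], first child [Leaf i] and further children [ts] denotes the
    [k]-th entry of the chosen solution of [C i s], where [s] lists the values
    of [ts]. *)
Lemma skolem_hull : exists S : {pred B},
  [/\ b0 \in S, embeds {x | x \in S} K &
      forall i s, {subset s <= S} -> (exists t, C i s t) ->
        exists2 t, C i s t & {subset t <= S}].
Proof.
have /choice [sk' skP'] : forall p : I * seq B, exists t,
    (exists t, C p.1 p.2 t) -> C p.1 p.2 t.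
  move=> [i s]; have [[t Ct]|nC] := pselect (exists t, C i s t); first by exists t.
  by exists [::] => Ct; case: nC.
pose sk i s := sk' (i, s).
pose eval := fix eval (t : GenTree.tree I) : B :=
  match t with
  | GenTree.Node k (GenTree.Leaf i :: ts) => nth b0 (sk i (map eval ts)) k
  | _ => b0
  end.
pose S : {pred B} := fun x => `[< exists t, x = eval t >].
exists S; split.
- by apply/asboolP; exists (GenTree.Node 0 [::]).
- have /choice [tm tmP] : forall x : {x | x \in S}, exists t, val x = eval t.
    by move=> [x /= /asboolP].
  apply: (@embeds_trans _ (seq (nat + I))).
    exists (fun x => GenTree.encode (tm x)) => x y /(pcan_inj (@GenTree.codeK _)) e.
    by apply: val_inj; rewrite !tmP e.
  apply: (@embeds_trans _ (seq K)); last exact: embeds_seq nuI.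
  by have [f fI] := IK; exists (map f); exact: inj_map.
- move=> i s sS [t Ct]; exists (sk i s).
    by apply: (skP' (i, s)); exists t.
  have [ts <-] : exists ts, map eval ts = s.
    elim: s sS {Ct} => [|x s IHs] sS; first by exists [::].
    have [ts <-] := IHs (fun y ys => sS y (mem_behead (s := x :: s) ys)).
    have /asboolP [u ->] := sS x (mem_head _ _).
    by exists (u :: ts).
  move=> x xsk; apply/asboolP.
  exists (GenTree.Node (index x (sk i (map eval ts))) (GenTree.Leaf i :: ts)).
  by rewrite /= nth_index.
Qed.
End SkolemHull.

(** * Submodules and quotient modules *)

Section LinearOf.
Variables (R : pzRingType) (U V : lmodType R).

Definition linear_of (f : U -> V) (fL : linear f) : {linear U -> V} :=
  HB.pack f (GRing.isLinear.Build R U V *:%R f fL).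
End LinearOf.

Section Submodules.
Variables (R : pzRingType) (V : lmodType R).

Definition submod_pack (S : {pred V}) (SP : submod_closed S) : submodClosed V :=
  HB.pack (S : V -> bool) (GRing.isSubmodClosed.Build R V S SP).

Record submodule (S : {pred V}) (SP : submod_closed S) :=
  Submodule { submodule_val : V; _ : submodule_val \in submod_pack SP }.

Variables (S : {pred V}) (SP : submod_closed S).
HB.instance Definition _ := [isSub for @submodule_val S SP].
HB.instance Definition _ := [Choice of submodule SP by <:].
HB.instance Definition _ := [SubChoice_isSubLmodule of submodule SP by <:].

Definition submod_incl : {linear submodule SP -> V} := val.
Definition to_submod (x : V) (xS : x \in S) : submodule SP :=
  Submodule (SP := SP) xS.

Lemma submod_incl_inj : injective submod_incl. Proof. exact: val_inj. Qed.

Lemma submod_inclP (x : submodule SP) : submod_incl x \in S.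
Proof. exact: (valP x). Qed.

Lemma submod_incl_to (x : V) (xS : x \in S) :
  submod_incl (to_submod xS) = x.
Proof. by []. Qed.

End Submodules.
Arguments submod_incl {R V S SP}.

Section Quotients.
Variables (R : pzRingType) (V : lmodType R) (S : {pred V}) (SP : submod_closed S).

Definition zmod_pack : zmodClosed V :=
  HB.pack (S : V -> bool) (GRing.isZmodClosed.Build V S (GRing.submod_closedB SP)).
Definition quotient_module := Quotient.quot zmod_pack.
HB.instance Definition _ := GRing.Zmodule.on quotient_module.

Definition quot_proj (x : V) : quotient_module := (\pi x)%qT.

Lemma quot_projE x y : quot_proj x = quot_proj y <-> x - y \in S.
Proof.
split=> [/eqP|h]; last by apply/eqP; rewrite /quot_proj -Quotient.idealrBE.
by rewrite /quot_proj -Quotient.idealrBE.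
Qed.

Definition quot_scale (r : R) (x : quotient_module) : quotient_module :=
  quot_proj (r *: repr x).

Lemma quot_projD : {morph quot_proj : x y / x + y}.
Proof. by move=> x y; rewrite /quot_proj raddfD. Qed.

Lemma quot_scaleE r x : quot_scale r (quot_proj x) = quot_proj (r *: x).
Proof.
apply/quot_projE; rewrite -scalerBr; apply: (rpredZ (s := submod_pack SP)).
by apply/quot_projE; rewrite /quot_proj reprK.
Qed.

Lemma quot_proj_surj (x : quotient_module) : exists y, x = quot_proj y.
Proof. by exists (repr x); rewrite /quot_proj reprK. Qed.

Lemma quot_scaleA a b v : quot_scale a (quot_scale b v) = quot_scale (a * b) v.
Proof. by have [y ->] := quot_proj_surj v; rewrite !quot_scaleE scalerA. Qed.

Lemma quot_scale1 : left_id 1 quot_scale.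
Proof.
by move=> v; have [y ->] := quot_proj_surj v; rewrite !quot_scaleE scale1r.
Qed.

Lemma quot_scaleDr : right_distributive quot_scale +%R.
Proof.
move=> a v w; have [y ->] := quot_proj_surj v; have [z ->] := quot_proj_surj w.
by rewrite -quot_projD !quot_scaleE scalerDr quot_projD.
Qed.

Lemma quot_scaleDl v : {morph quot_scale^~ v : a b / a + b}.
Proof.
move=> a b; have [y ->] := quot_proj_surj v.
by rewrite !quot_scaleE scalerDl quot_projD.
Qed.
HB.instance Definition _ := GRing.Zmodule_isLmodule.Build R quotient_module
  quot_scaleA quot_scale1 quot_scaleDr quot_scaleDl.

Lemma quot_proj_is_linear : linear quot_proj.
Proof. by move=> a x y; rewrite quot_projD -quot_scaleE. Qed.
HB.instance Definition _ := GRing.isLinear.Build R V quotient_module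
  *:%R quot_proj quot_proj_is_linear.

Lemma quotient_lift (W : lmodType R) (h : {linear V -> W}) :
  (forall x, x \in S -> h x = 0) ->
  exists h' : {linear quotient_module -> W}, forall x, h' (quot_proj x) = h x.
Proof.
move=> hS; pose h' (x : quotient_module) := h (repr x).
have h'E x : h' (quot_proj x) = h x.
  apply/eqP; rewrite -subr_eq0 -linearB hS //; apply/quot_projE.
  by rewrite /quot_proj reprK.
have h'L : linear h'.
  move=> a x y; have [u ->] := quot_proj_surj x; have [v ->] := quot_proj_surj y.
  by rewrite -linearP !h'E linearP.
by exists (linear_of h'L).
Qed.
End Quotients.

(** * Finitely many linear relations *)

Section Relations.
Variable R : pzRingType.

Definition is_relation (M : lmodType R) (t : seq (R * M)) : Prop :=
  \sum_(p <- t) p.1 *: p.2 = 0.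

(** Passing between relations on elements and matrices: after the elements
    that occur are numbered by [idx], the list [c] of relations becomes a
    matrix [r] whose rows may be applied in any module. *)
Lemma coefficient_matrix (M : lmodType R) (c : seq (seq (R * M))) (Y : seq M) :
  exists n (idx : M -> 'I_n) (y : 'I_n -> M) (r : 'M[R]_(size c, n)),
  [/\ {in Y, forall m, y (idx m) = m},
      forall t, t \in c -> {in t, forall p, y (idx p.2) = p.2} &
      forall (V : lmodType R) (psi : 'I_n -> V) (i : 'I_(size c)),
        \sum_(j < n) r i j *: psi j =
        \sum_(p <- nth [::] c i) p.1 *: psi (idx p.2)].
Proof.
pose L := Y ++ flatten [seq [seq p.2 | p <- t] | t <- c].
(* The extra index keeps the range of [idx] nonempty. *)
pose idx m : 'I_(size L).+1 := inord (index m L).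
have idxK m : m \in L -> nth 0 L (idx m) = m.
  by move=> mL; rewrite inordK ?nth_index // ltnS index_size.
exists (size L).+1, idx, (fun j => nth 0 L j),
  (\matrix_(i, j) \sum_(p <- nth [::] c i | idx p.2 == j) p.1); split.
- by move=> m mY; apply: idxK; rewrite mem_cat mY.
- move=> t tc p pt; apply: idxK; rewrite mem_cat; apply/orP; right.
  by apply/flattenP; exists [seq p.2 | p <- t]; exact: map_f.
- move=> V psi i; under eq_bigr do rewrite mxE scaler_suml.
  rewrite (exchange_big_dep xpredT) //=; apply: eq_bigr => p _.
  by rewrite (big_pred1 (idx p.2)) // => j; rewrite eq_sym.
Qed.

Definition equationally_flat (F : lmodType R) : Prop :=
  forall m n (r : 'M[R]_(m, n)) (x : 'I_n -> F),
    (forall i, \sum_(j < n) r i j *: x j = 0) ->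
  exists k (w : 'I_k -> F) (U : 'M[R]_(n, k)),
    (forall j, x j = \sum_(l < k) U j l *: w l) /\
    r *m U = 0.

(** The factorization through a free module, with coefficients [U] indexed by
    elements instead of numbers. *)
Lemma equationally_flat_relations (F : lmodType R) (c : seq (seq (R * F)))
    (Y : seq F) :
  equationally_flat F -> (forall t, t \in c -> is_relation t) ->
  exists k (w : 'I_k -> F) (U : F -> 'I_k -> R),
    {in Y, forall m, m = \sum_(l < k) U m l *: w l} /\
    forall t, t \in c -> forall l, \sum_(p <- t) p.1 * U p.2 l = 0.
Proof.
move=> flatF crel.
have [n [idx [y [r [yY yc rE]]]]] := coefficient_matrix c Y.
have [|k [w [U [yU rU]]]] := flatF _ _ r y.
  move=> i; rewrite rE; have ti := mem_nth [::] (ltn_ord i).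
  rewrite -[RHS](crel _ ti); apply: eq_big_seq => p pt.
  by rewrite (yc _ ti).
exists k, w, (fun m => U (idx m)); split=> [m mY|t tc l].
  by rewrite -yU yY.
have ilt : (index t c < size c)%N by rewrite index_mem.
have := rE R^o (fun j => U j l) (Ordinal ilt); rewrite /= nth_index // => <-.
by move/matrixP: rU => /(_ (Ordinal ilt) l); rewrite !mxE.
Qed.

(** A pure embedding has a retraction as far as finitely many relations can
    tell: they form a system, solved in [B] by the elements themselves, and the
    additional equation on the unknown for [f a] makes the solution in [A]
    respect [a]. *)
Lemma pure_embedding_relations (A B : lmodType R) (f : {linear A -> B}) (a : A)
    (c : seq (seq (R * B))) :
  pure_embedding f -> (forall t, t \in c -> is_relation t) ->
  exists theta : B -> A, theta (f a) = a /\
    forall t, t \in c -> \sum_(p <- t) p.1 *: theta p.2 = 0.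
Proof.
move=> [_ fpure] crel.
(* The first row expresses that the unknown for [f a] takes the value [a]. *)
have [n [idx [y [r [_ yc rE]]]]] := coefficient_matrix ([:: (1, f a)] :: c) [::].
have [|x xE] := fpure _ _ r (fun i => if i == ord0 then a else 0).
  exists y => i; rewrite rE; have ti := mem_nth [::] (ltn_ord i).
  case: eqP ti => [->|/eqP i0] /= ti.
    by rewrite big_seq1 /= scale1r; exact: (yc _ ti (1, f a) (mem_head _ _)).
  rewrite linear0; have ti' : nth [::] ([:: (1, f a)] :: c) i \in c.
    by case: i i0 {ti} => -[//|i] /= ilt _; exact: mem_nth.
  rewrite -[RHS](crel _ ti'); apply: eq_big_seq => p pt.
  by rewrite (yc _ ti).
exists (x \o idx); split=> [|t tc].
  by have := xE ord0; rewrite rE /= big_seq1 scale1r.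
have ilt : ((index t c).+1 < size ([:: (1%R, f a)] :: c))%N.
  by rewrite /= ltnS index_mem.
by have := xE (Ordinal ilt); rewrite rE /= nth_index.
Qed.

End Relations.

(** * Vanishing tensors *)

Section TensorRelations.
Variables (R : pzRingType) (N : lmodType R^c) (M : lmodType R).

Definition tensl (m : M) (n : N) : tensor N M := tens n m.

Lemma tensl_is_zmod_morphism (m : M) : zmod_morphism (tensl m).
Proof.
by move=> n n'; apply: (addIr (tens n' m)); rewrite -tensDl !addrNK.
Qed.
HB.instance Definition _ (m : M) :=
  GRing.isZmodMorphism.Build N (tensor N M) (tensl m) (tensl_is_zmod_morphism m).

Lemma tens_is_zmod_morphismr (n : N) :
  zmod_morphism (tens n : M -> tensor N M).
Proof.
by move=> m m'; apply: (addIr (tens n m')); rewrite -tensDr !addrNK.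
Qed.
HB.instance Definition _ (n : N) :=
  GRing.isZmodMorphism.Build M (tensor N M) (tens n) (tens_is_zmod_morphismr n).

Lemma tensor_generated (t : tensor N M) :
  exists l : seq (N * M), t = \sum_(p <- l) tens p.1 p.2.
Proof.
rewrite -[t]reprK -[repr t]freeg_repr.
elim: (val (repr (repr t))) => [|[z [n m]] s [l lE]].
  by exists [::]; rewrite big_nil /=; exact: (raddf0 (\pi_(tensor N M))%qT).
exists ((n *~ z, m) :: l); rewrite big_cons -lE /=.
have -> : [freeg (z, (n, m)) :: s] = << (n, m) >> *~ z + [freeg s].
  rewrite freegU_mulz intz; apply/eqP/freeg_eqP => k.
  by rewrite coeffD !coeff_Freeg !precoeff_cons precoeff_nil addr0.
rewrite raddfD /= raddfMz; congr (_ + _).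
by rewrite -/(tensl m _) raddfMz.
Qed.

(** N (x) M is the quotient of the finitely supported functions from M to N by
    those of the form n t, where t is a relation in M.  Each function phi,
    additive in its first argument only, defines a map on such functions, and
    so testing against all phi states the equality there. *)
Lemma tens_sum_eq0 (l : seq (N * M)) : \sum_(p <- l) tens p.1 p.2 = 0 ->
  exists c : seq (N * seq (R * M)),
    (forall q, q \in c -> is_relation q.2) /\
    forall (Z : zmodType) (phi : N -> M -> Z),
      (forall m, zmod_morphism (phi^~ m)) ->
      \sum_(p <- l) phi p.1 p.2 =
      \sum_(q <- c) \sum_(p <- q.2) phi ((p.1 : R^c) *: q.1) p.2.
Proof.
move=> l0.
have : tensor_relation (\sum_(p <- l) << p >> : {freeg (N * M)%type / int}).
  rewrite -[X in tensor_relation X]subr0; apply/tensor_eqP/eqP.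
  rewrite !raddf_sum raddf0 -[RHS]l0 /=; apply: eq_bigr => -[n m] _.
  by rewrite /tens.
have liftB (Z : zmodType) (phi : N -> M -> Z) :
    {morph fglift (fun p : N * M => phi p.1 p.2 : zmodule Z) : x y / x - y}.
  exact: lift_is_additive.
have liftU1 (Z : zmodType) (phi : N -> M -> Z) n m :
    fglift (fun p : N * M => phi p.1 p.2 : zmodule Z) << (n, m) >> = phi n m.
  by rewrite liftU scale1r.
have lift0 (Z : zmodType) (phi : N -> M -> Z) :
    fglift (fun p : N * M => phi p.1 p.2 : zmodule Z) 0 = 0.
  by rewrite -(subrr 0) liftB subrr.
have lift_sum (Z : zmodType) (phi : N -> M -> Z) :
    \sum_(p <- l) phi p.1 p.2 =
    fglift (fun p : N * M => phi p.1 p.2 : zmodule Z) (\sum_(p <- l) << p >>).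
  elim: l {l0} => [|[n m] l IHl]; rewrite ?big_nil ?big_cons.
    by rewrite lift0.
  have -> : << (n, m) >> + \sum_(p <- l) << p >> =
      \sum_(p <- l) << p >> - (0 - << (n, m) >>) :> {freeg (N * M)%type / int}.
    by rewrite sub0r opprK addrC.
  by rewrite !liftB liftU1 lift0 IHl /= sub0r opprK addrC.
move=> rel.
(* Additivity in [m] and the balancing rule are, up to sign, multiples of
   relations; additivity in [n] holds before passing to the quotient. *)
suff [c [crel cE]] : exists c : seq (N * seq (R * M)),
    (forall q, q \in c -> is_relation q.2) /\
    forall (Z : zmodType) (phi : N -> M -> Z),
      (forall m, zmod_morphism (phi^~ m)) ->
      fglift (fun p : N * M => phi p.1 p.2 : zmodule Z) (\sum_(p <- l) << p >>) =
      \sum_(q <- c) \sum_(p <- q.2) phi ((p.1 : R^c) *: q.1) p.2.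
  by exists c; split=> // Z phi phiB; rewrite lift_sum cE.
have phiN (Z : zmodType) (phi : N -> M -> Z) :
    (forall m, zmod_morphism (phi^~ m)) -> forall n m, phi (- n) m = - phi n m.
  move=> phiB n m; have phi0 : phi 0 m = 0 by have := phiB m 0 0; rewrite !subrr.
  by have := phiB m 0 n; rewrite phi0 !sub0r.
have scN (n : N) : ((-1 : R) : R^c) *: n = - n by exact: scaleN1r.
elim: rel => [n n' m|n m m'|n r m||x y _ [c [crel cE]] _ [d [drel dE]]].
- exists [::]; split=> // Z phi phiB; rewrite big_nil !liftB !liftU1.
  by have := phiB m (n + n') n; rewrite addrAC subrr add0r => ->; rewrite subrr.
- exists [:: (n, [:: (1, m + m'); (-1, m); (-1, m')])]; split=> [q|Z phi phiB].
    rewrite mem_seq1 => /eqP ->; rewrite /is_relation !big_cons big_nil /=.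
    by rewrite scale1r !scaleN1r addr0 -opprD subrr.
  rewrite !liftB !liftU1 big_seq1 !big_cons big_nil /= addr0 scale1r.
  by rewrite scN !(phiN _ _ phiB) addrA.
- exists [:: (n, [:: (r, m); (-1, r *: m)])]; split=> [q|Z phi phiB].
    rewrite mem_seq1 => /eqP ->; rewrite /is_relation !big_cons big_nil /=.
    by rewrite scaleN1r addr0 subrr.
  rewrite !liftB !liftU1 big_seq1 !big_cons big_nil /= addr0.
  by rewrite scN (phiN _ _ phiB).
- by exists [::]; split=> // Z phi _; rewrite big_nil lift0.
- exists (c ++ [seq (- q.1, q.2) | q <- d]); split=> [q|Z phi phiB].
    by rewrite mem_cat => /orP [/crel //|/mapP [q' /drel q'r ->]].
  rewrite liftB cE // dE // big_cat big_map /= -sumrN; congr (_ + _).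
  apply: eq_bigr => q _; rewrite -sumrN; apply: eq_bigr => p _.
  by rewrite scalerN (phiN _ _ phiB).
Qed.
End TensorRelations.

(** * Flat modules *)

Section Flat.
Variable R : pzRingType.

(** If f (x) F kills a tensor, rewrite the relations responsible for it by a
    factorization through a free module R^k: there they vanish, and so do the
    k coordinates of the image of the tensor, which lie in N'.  As f is
    injective, the coordinates in N already vanish. *)
Lemma equationally_flat_flat (F : lmodType R) : equationally_flat F -> flat F.
Proof.
move=> Fflat N N' f f_inj; apply: raddf_inj => t.
have [l ->] := tensor_generated t; rewrite raddf_sum /=.
under eq_bigr do rewrite tensor_map_tens.
rewrite -(big_map (fun p : N * F => (f p.1, p.2)) xpredT (fun p => tens p.1 p.2)).
move=> /tens_sum_eq0 [c [crel cE]].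
have [|k [w [U [Uw Uc]]]] :=
  @equationally_flat_relations _ F [seq q.2 | q <- c] [seq p.2 | p <- l] Fflat.
  by move=> _ /mapP [q /crel q0 ->].
have U0 j : \sum_(p <- l) (U p.2 j : R^c) *: p.1 = 0.
  apply: f_inj; rewrite raddf0 raddf_sum /=.
  under eq_bigr do rewrite linearZ /=.
  have := cE N' (fun n m => (U m j : R^c) *: n).
  rewrite big_map /= => ->; last first.
    by move=> m n n'; rewrite scalerBr.
  apply: big1_seq => q /andP [_ qc]; under eq_bigr do rewrite scalerA.
  have := Uc _ (map_f snd qc) j; rewrite -scaler_suml => U0.
  by rewrite -[RHS](scale0r q.1); congr (_ *: _).
have -> : \sum_(p <- l) tens p.1 p.2 =
    \sum_(p <- l) \sum_(j < k) tens ((U p.2 j : R^c) *: p.1) (w j).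
  apply: eq_big_seq => p pl; rewrite {1}(Uw p.2 (map_f snd pl)) raddf_sum /=.
  by apply: eq_bigr => j _; rewrite tensZ.
rewrite exchange_big big1 //= => j _.
have := raddf_sum (tensl (w j)) l xpredT (fun p => (U p.2 j : R^c) *: p.1).
by rewrite U0 raddf0 => <-.
Qed.

Lemma sum_by_value (V : lmodType R) (T : eqType) (s : seq T) (a : T -> R)
    (v : T -> V) (L : seq V) : uniq L -> {in s, forall x, v x \in L} ->
  \sum_(y <- L) (\sum_(x <- s | v x == y) a x) *: y = \sum_(x <- s) a x *: v x.
Proof.
move=> uL; elim: s => [|x s IHs] sL.
  by rewrite big_nil big1 // => y _; rewrite big_nil scale0r.
rewrite big_cons -IHs; last by move=> y ys; apply: (sL); rewrite in_cons ys orbT.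
have xL : v x \in L by apply: (sL); exact: mem_head.
rewrite (bigD1_seq (v x)) //= [in RHS](bigD1_seq (v x)) //= addrA.
congr (_ + _); first by rewrite big_cons eqxx scalerDl.
by apply: eq_bigr => y yx; rewrite big_cons eq_sym (negbTE yx).
Qed.

Section FlatEquations.
Variables (F : lmodType R) (m n : nat) (r : 'M[R]_(m, n)) (x : 'I_n -> F).

(** The matrix [r] as a map of right modules R^n -> R^m on rows over the
    converse ring. *)
Definition right_action : 'M[R^c]_(n, m) := r^T.

Definition right_image : {pred 'rV[R^c]_m} :=
  fun v => `[< exists u : 'rV[R^c]_n, v = u *m right_action >].

Lemma right_image_closed : submod_closed right_image.
Proof.
split; first by apply/asboolP; exists 0; rewrite mul0mx.
move=> a _ _ /asboolP [u ->] /asboolP [v ->]; apply/asboolP.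
by exists (a *: u + v); rewrite mulmxDl scalemxAl.
Qed.

Lemma delta_image (j : 'I_n) : delta_mx 0 j *m right_action \in right_image.
Proof. by apply/asboolP; exists (delta_mx 0 j). Qed.

Let gen j := to_submod right_image_closed (delta_image j).

(** Let I be the image of the map of right modules R^n -> R^m with matrix r,
    and K its kernel.  The sum of the tensors r(e_j) (x) x_j vanishes in
    R^m (x) F because r x = 0, hence vanishes in I (x) F by flatness.  Lifting
    the relations that witness this to R^n shows that x is a combination of
    elements of F with coefficients in K. *)
Lemma flat_equation_solution : flat F ->
    (forall i, \sum_(j < n) r i j *: x j = 0) ->
  exists k (w : 'I_k -> F) (U : 'M[R]_(n, k)),
    (forall j, x j = \sum_(l < k) U j l *: w l) /\ r *m U = 0.
Proof.
move=> Fflat rx0.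
have : \sum_(p <- [seq (gen j, x j) | j <- enum 'I_n]) tens p.1 p.2 = 0.
  apply: (Fflat _ _ _ (@submod_incl_inj _ _ _ right_image_closed)).
  rewrite raddf0 raddf_sum big_map /= big_enum /=.
  have genE j : submod_incl (gen j) = \sum_(i < m) (r i j : R^c) *: delta_mx 0 i.
    rewrite submod_incl_to -rowE; apply/rowP => i.
    rewrite !mxE summxE (bigD1 i) //= !mxE !eqxx big1 ?addr0 => [|i' /negPf i'i].
      by rewrite mulr1.
    by rewrite !mxE eqxx eq_sym i'i /= mulr0.
  under eq_bigr => j _ do rewrite tensor_map_tens genE -/(tensl _ _) raddf_sum /=.
  rewrite exchange_big big1 //= => i _.
  under eq_bigr => j _ do rewrite /tensl tensZ.
  by rewrite -raddf_sum rx0 raddf0.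
move=> /tens_sum_eq0 [c [crel cE]].
have /choice [u uE] : forall v : submodule right_image_closed,
    exists u : 'rV[R^c]_n, submod_incl v = u *m right_action.
  by move=> v; have /asboolP := submod_inclP v.
pose X := [seq x j | j <- enum 'I_n] ++ flatten [seq [seq p.2 | p <- q.2] | q <- c].
pose L := undup X; have uL : uniq L := undup_uniq _.
have xL j : x j \in L by rewrite mem_undup mem_cat map_f // mem_enum.
have cL q : q \in c -> {in q.2, forall p, p.2 \in L}.
  move=> qc p pq; rewrite mem_undup mem_cat; apply/orP; right.
  apply/flattenP; exists [seq p.2 | p <- q.2]; last exact: map_f.
  by apply/mapP; exists q.
(* [kappa y] collects the coefficients of [y] in the sum of the e_j (x) x_j
   minus the lifted relations; it lies in the kernel of [r]. *)
pose kappa (y : F) : 'rV[R^c]_n := \sum_(j < n | x j == y) delta_mx 0 j -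
  \sum_(q <- c) \sum_(p <- q.2 | p.2 == y) (p.1 : R^c) *: u q.1.
have kappa0 y : kappa y *m right_action = 0.
  (* Testing with this function extracts the coefficient of [y]. *)
  have := cE _ (fun v z => if z == y then submod_incl v else 0).
  rewrite big_map big_enum /= => e.
  apply/eqP; rewrite mulmxBl subr_eq0; apply/eqP.
  rewrite mulmx_suml big_mkcond /= e; last first.
    by move=> z v v'; case: eqP => _; rewrite ?raddfB ?subrr.
  rewrite mulmx_suml; apply: eq_bigr => q _; rewrite mulmx_suml [RHS]big_mkcond.
  apply: eq_bigr => p _; case: eqP => _ //.
  by rewrite -[submodule_val q.1]/(submod_incl q.1) uE scalemxAl.
exists (size L), (fun l => nth 0 L l), (\matrix_(j, l) (kappa (nth 0 L l) 0 j : R)).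
split=> [j|]; last first.
  apply/matrixP => i l; rewrite mxE [RHS]mxE.
  have /rowP/(_ i) := kappa0 (nth 0 L l); rewrite mxE [RHS]mxE => {2}<-.
  by apply: eq_bigr => j _; rewrite !mxE.
under eq_bigr do rewrite mxE.
rewrite -(big_mkord xpredT (fun l => (kappa (nth 0 L l) 0 j : R) *: nth 0 L l)).
rewrite -(big_nth 0 xpredT (fun y => (kappa y 0 j : R) *: y)).
have kappaE y : (kappa y 0 j : R) =
    \sum_(i <- enum 'I_n | x i == y) (j == i)%:R -
    \sum_(q <- c) \sum_(p <- q.2 | p.2 == y) (u q.1 0 j : R) * p.1.
  rewrite /kappa mxE [in LHS]mxE summxE summxE big_enum_cond /=.
  congr (_ - _).
    by apply: eq_bigr => i _; rewrite mxE eqxx.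
  by apply: eq_bigr => q _; rewrite summxE; apply: eq_bigr => p _; rewrite mxE.
under eq_bigr do rewrite kappaE scalerBl scaler_suml.
rewrite sumrB sum_by_value //.
rewrite exchange_big /= [X in _ - X]big1_seq ?subr0.
  rewrite big_enum /= (bigD1 j) //= eqxx scale1r big1 ?addr0 // => i ij.
  by rewrite eq_sym (negbTE ij) scale0r.
move=> q /andP [_ qc]; rewrite sum_by_value //; last exact: cL.
under eq_bigr do rewrite -scalerA.
by rewrite -scaler_sumr (crel _ qc) scaler0.
Qed.
End FlatEquations.

Lemma flatP (F : lmodType R) : flat F <-> equationally_flat F.
Proof.
split=> [Fflat m n r x|]; last exact: equationally_flat_flat.
exact: flat_equation_solution.
Qed.

(** A factorization x = U w found in [B] is a system with matrix [U] and
    constants in [A], and purity solves it in [A]. *)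
Lemma flat_pure_sub (A B : lmodType R) (f : {linear A -> B}) :
  pure_embedding f -> flat B -> flat A.
Proof.
move=> [f_inj fpure] /flatP Bflat; apply/flatP => m n r x rx.
have [|k [w [U [wE rU]]]] := Bflat _ _ r (f \o x).
  move=> i; rewrite -[RHS](linear0 f) -(rx i) linear_sum /=.
  by apply: eq_bigr => j _; rewrite linearZ.
have [|z zE] := fpure _ _ U x; first by exists w => j; rewrite -wE.
by exists k, z, U; split=> // j; rewrite zE.
Qed.

(** A solution of r x = 0 in the quotient lifts to y with r y in [A]; purity
    corrects y by elements of [A] to a solution of r y = 0 in [B]. *)
Lemma flat_pure_quotient (A B G : lmodType R) (f : {linear A -> B})
    (g : {linear B -> G}) :
  pure_embedding f -> (forall z, exists y, g y = z) ->
  (forall y, g y = 0 <-> exists x, f x = y) -> flat B -> flat G.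
Proof.
move=> [f_inj fpure] g_surj gf /flatP Bflat; apply/flatP => m n r x rx.
have /choice [y yE] : forall j, exists y, g y = x j by move=> j; exact: g_surj.
have /choice [a aE] : forall i, exists a, f a = \sum_(j < n) r i j *: y j.
  move=> i; apply/gf; rewrite linear_sum /= -[RHS](rx i).
  by apply: eq_bigr => j _; rewrite linearZ /= yE.
have [|b bE] := fpure _ _ r a; first by exists y => i; rewrite aE.
have [|k [w [U [wE rU]]]] := Bflat _ _ r (fun j => y j - f (b j)).
  move=> i; under eq_bigr do rewrite scalerBr -linearZ /=.
  by rewrite sumrB -linear_sum bE aE subrr.
exists k, (g \o w), U; split=> // j; rewrite -yE.
have -> : g (y j) = g (y j - f (b j)).
  have gfb : g (f (b j)) = 0 by apply/gf; exists (b j).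
  by rewrite linearB /= gfb subr0.
by rewrite wE linear_sum; apply: eq_bigr => l _; rewrite linearZ.
Qed.

Section Extensions.
Variables (A B G : lmodType R) (f : {linear A -> B}) (g : {linear B -> G}).
Hypotheses (f_inj : injective f) (g_surj : forall z, exists y, g y = z).
Hypothesis gf : forall y, g y = 0 <-> exists x, f x = y.
Hypothesis Gflat : flat G.

(** Factor the image of [y] in [G] as U z with r U = 0 and lift z to w; what
    remains of [y] comes from [A]. *)
Let lift_flat m n (r : 'M[R]_(m, n)) (y : 'I_n -> B) :
    (forall i, g (\sum_(j < n) r i j *: y j) = 0) ->
  exists (b : 'I_n -> A) (k : nat) (w : 'I_k -> B) (U : 'M[R]_(n, k)),
    (forall j, y j = f (b j) + \sum_(l < k) U j l *: w l) /\ r *m U = 0.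
Proof.
move=> ry; have [|k [z [U [zE rU]]]] := (flatP G).1 Gflat _ _ r (g \o y).
  move=> i; rewrite -[RHS](ry i) linear_sum.
  by apply: eq_bigr => j _; rewrite linearZ.
have /choice [w wE] : forall l, exists w, g w = z l by move=> l; exact: g_surj.
have /choice [b bE] : forall j, exists b, f b = y j - \sum_(l < k) U j l *: w l.
  move=> j; apply/gf; rewrite raddfB /= linear_sum [g (y j)]zE.
  rewrite -sumrB big1 // => l _; by rewrite linearZ /= wE subrr.
by exists b, k, w, U; split=> // j; rewrite bE subrK.
Qed.

Let annihilated m n k (r : 'M[R]_(m, n)) (U : 'M[R]_(n, k)) (w : 'I_k -> B) i :
  r *m U = 0 -> \sum_(j < n) r i j *: (\sum_(l < k) U j l *: w l) = 0.
Proof.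
move=> rU; under eq_bigr do rewrite scaler_sumr.
rewrite exchange_big big1 //= => l _; under eq_bigr do rewrite scalerA.
rewrite -scaler_suml; move/matrixP/(_ i l): rU; rewrite !mxE => ->.
by rewrite scale0r.
Qed.

(** The part U w of a solution is annihilated by [r], so that the part in [A]
    is itself a solution. *)
Lemma flat_cokernel_pure : pure_embedding f.
Proof.
split=> // m n r a [y ry].
have [|b [k [w [U [yE rU]]]]] := @lift_flat _ _ r y.
  by move=> i; rewrite ry; apply/gf; exists (a i).
exists b => i; apply: f_inj; rewrite -ry linear_sum.
under [RHS]eq_bigr do rewrite yE scalerDr -linearZ.
by rewrite big_split /= annihilated // addr0.
Qed.

(** The part in [A] solves the homogeneous system, hence factors as well; the two
    factorizations are placed side by side. *)
Lemma flat_extension : flat A -> flat B.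
Proof.
move=> /flatP Aflat; apply/flatP => m n r y ry.
have [|b [k [w [U [yE rU]]]]] := @lift_flat _ _ r y.
  by move=> i; rewrite ry linear0.
have [|k' [w' [U' [bE rU']]]] := Aflat _ _ r b.
  move=> i; apply: f_inj; rewrite linear0 linear_sum -[RHS](ry i).
  under [RHS]eq_bigr do rewrite yE scalerDr -linearZ.
  by rewrite big_split /= annihilated // addr0.
exists (k' + k)%N, 
  (fun l => match fintype.split l with inl l1 => f (w' l1) | inr l2 => w l2 end).
exists (row_mx U' U); split=> [j|]; last by rewrite mul_mx_row rU rU' row_mx0.
rewrite big_split_ord yE bE linear_sum /=; congr (_ + _); apply: eq_bigr => l _.
  rewrite row_mxEl linearZ; case: fintype.splitP => l1 /= e.
    by rewrite (ord_inj e).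
  by have := ltn_ord l; rewrite e ltnNge leq_addr.
rewrite row_mxEr; case: fintype.splitP => l1 /= e.
  by have := ltn_ord l1; rewrite -e ltnNge leq_addr.
by rewrite (ord_inj (addnI e)).
Qed.
End Extensions.
End Flat.

(** * s-torsion modules *)

(** The relations that witness 1 (x) f a = 0 live on finitely many elements of
    [B]; purity moves them to [A] while fixing [a], and they witness
    1 (x) a = 0 there. *)
Lemma s_torsion_pure_sub (R : pzRingType) (ER : lmodType R^c)
    (i : {linear regular_right R -> ER}) (A B : lmodType R) (f : {linear A -> B}) :
  pure_embedding f -> s_torsion i B -> s_torsion i A.
Proof.
move=> fpure Btor; apply/seteqP; split=> // a _.
have : s_radical i B (f a) by rewrite Btor.
rewrite /s_radical /= !tensor_map_tens => ia0.
have [|c [crel cE]] := @tens_sum_eq0 _ ER B [:: (i (1 : R^c), f a)].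
  by rewrite big_seq1.
have [|theta [thetaa thetac]] :=
  @pure_embedding_relations _ _ _ f a [seq q.2 | q <- c] fpure.
  by move=> _ /mapP [q /crel q0 ->].
have := cE (tensor ER A) (fun n b => tens n (theta b)).
rewrite big_seq1 /= thetaa => ->; last first.
  by move=> b; exact: tensl_is_zmod_morphism.
apply: big1_seq => q /andP [_ qc]; under eq_bigr do rewrite tensZ.
by rewrite -raddf_sum thetac ?map_f // raddf0.
Qed.

(** * Small hulls closed under solving linear systems *)

Section Hull.
Variables (R : pzRingType) (B : lmodType R).

(** Closure of a submodule S under solving r t = s anywhere in [B] makes S pure
    in [B]; closure under solving it inside [D] makes the intersection of S
    and [D] pure in S; closure under solving it modulo [D] makes D + S pure. *)
Definition solves (D : {pred B}) (inD modD : bool) m n (r : 'M[R]_(m, n))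
    (s : 'I_m -> B) (t : 'I_n -> B) : Prop :=
  (inD -> forall j, t j \in D) /\
  forall i, if modD then is_true (\sum_(j < n) r i j *: t j - s i \in D)
            else \sum_(j < n) r i j *: t j = s i.

Definition system : Type :=
  (bool * bool * {mn : nat * nat & 'M[R]_(mn.1, mn.2)})%type.

(** A sequence coding a system begins with its two flags and its dimensions, so
    that the length tells it apart from the codes of numbers and scalars. *)
Lemma embeds_system : embeds (nat + (R + system)) (R + nat).
Proof.
have inrI : injective (@inr R nat) by move=> x y [].
apply: embeds_trans (embeds_seq inrI).
exists (fun x : nat + (R + system) => match x with
  | inl k => [:: inr k]
  | inr (inl r) => [:: inl r]
  | inr (inr (b, b', existT mn r)) =>
      [:: inr (nat_of_bool b), inr (nat_of_bool b'), inr mn.1, inr mn.2 &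
          [seq inl (r p.1 p.2) | p <- enum {: 'I_mn.1 * 'I_mn.2}]]
  end).
move=> [x|[x|[[b b'] [[m n] r]]]] [y|[y|[[c c'] [[m' n'] r']]]] //=.
- by case=> ->.
- by case=> ->.
case=> bc bc' mm' nn'; subst m' n' => /eq_in_map rr'.
have -> : b = c by move: b c bc {rr'} => [] [].
have -> : b' = c' by move: b' c' bc' {rr'} => [] [].
do 4 congr (_ _); apply/matrixP => i j.
by have [] := rr' (i, j) (mem_enum _ _).
Qed.

Lemma hull (D : {pred B}) (b : B) :
  exists (S : {pred B}) (SP : submod_closed S),
  [/\ b \in S, small_module (submodule SP) &
      forall (inD modD : bool) m n (r : 'M[R]_(m, n)) (s : 'I_m -> B),
        (forall i, s i \in S) -> (exists t, solves D inD modD r s t) ->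
        exists2 t, solves D inD modD r s t & forall j, t j \in S].
Proof.
have inrI : injective (@inr R nat) by move=> x y [].
pose C (i : R + system) (s t : seq B) : Prop :=
  match i with
  | inl r => t = [:: r *: nth 0 s 0 + nth 0 s 1]
  | inr (inD, modD, existT mn r) => size t = mn.2 /\
      solves D inD modD r (fun i => nth 0 s i) (fun j => nth 0 t j)
  end.
have [S [bS Ssmall SC]] := skolem_hull b inrI embeds_system C.
have Slin r u v : u \in S -> v \in S -> r *: u + v \in S.
  move=> uS vS; have [||_ -> sub] := SC (inl r) [:: u; v].
  - by move=> x; rewrite !inE => /orP [] /eqP ->.
  - by eexists; reflexivity.
  by apply: sub; rewrite mem_head.
have SP : submod_closed S.
  split=> [|r u v]; last exact: Slin.
  by rewrite -(addNr b) -scaleN1r; exact: Slin.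
exists S, SP; split=> // [|inD modD m n r s sS [t [tD tE]]].
  apply/embeds_card; apply: embeds_trans Ssmall.
  exists (fun x => exist _ (submod_incl x) (submod_inclP x)) => x y.
  by move=> /(congr1 sval) /= /val_inj.
have nt (k : nat) (u : 'I_k -> B) (j : 'I_k) : nth 0 (map u (enum 'I_k)) j = u j.
  by rewrite (nth_map j) ?size_enum_ord // nth_ord_enum.
have [||t' [size_t' [t'D t'E]] t'S] :=
    SC (inr (inD, modD, existT _ (m, n) r)) (map s (enum 'I_m)).
- by move=> _ /mapP [i _ ->].
- exists (map t (enum 'I_n)); split=> /=; first by rewrite size_map size_enum_ord.
  rewrite (_ : (fun i => _) = s); last exact/funext/nt.
  by rewrite (_ : (fun j => _) = t); last exact/funext/nt.
exists (fun j => nth 0 t' j); last by move=> j; apply: t'S; rewrite mem_nth ?size_t'.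
by split=> // i; have := t'E i; rewrite nt.
Qed.
End Hull.

(** * Extending along relatively pure embeddings *)

Section RelativePurity.
Variable R : pzRingType.
Variable Mx : forall m n, 'M[R]_(m, n) -> Prop.

(** The class [Mx] interpolates between arbitrary embeddings, for the empty
    class, and pure embeddings, for the class of all matrices. *)
Definition Mx_pure (A B : lmodType R) (f : {linear A -> B}) : Prop :=
  injective f /\
  forall m n (r : 'M[R]_(m, n)), Mx r -> forall a : 'I_m -> A,
    (exists y : 'I_n -> B, forall i, \sum_(j < n) r i j *: y j = f (a i)) ->
    exists x : 'I_n -> A, forall i, \sum_(j < n) r i j *: x j = a i.

Section Fixed.
Variables (A B E : lmodType R) (f : {linear A -> B}) (g : {linear A -> E}).
Hypothesis f_pure : Mx_pure f.

Definition dom_of (G : set (B * E)) : {pred B} :=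
  fun b => `[< exists e, G (b, e) >].

Lemma dom_ofP G b : reflect (exists e, G (b, e)) (b \in dom_of G).
Proof. exact: asboolP. Qed.

Definition Mx_pure_set (D : {pred B}) : Prop :=
  forall m n (r : 'M[R]_(m, n)), Mx r -> forall y : 'I_n -> B,
    (forall i, \sum_(j < n) r i j *: y j \in D) ->
    exists2 x : 'I_n -> B, forall j, x j \in D &
      forall i, \sum_(j < n) r i j *: x j = \sum_(j < n) r i j *: y j.

Definition partial_extension (G : set (B * E)) : Prop :=
  [/\ forall r p q, G p -> G q -> G (r *: p + q),
      forall a, G (f a, g a),
      forall e, G (0, e) -> e = 0 &
      Mx_pure_set (dom_of G)].

Lemma partial_extension_graph : partial_extension [set (f a, g a) | a in setT].
Proof.
split.
- move=> r _ _ [a _ <-] [b _ <-]; exists (r *: a + b) => //.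
  by rewrite !linearP.
- by move=> a; exists a.
- by move=> e [a _ [fa <-]]; rewrite (f_pure.1 a 0) ?linear0.
- move=> m n r Mr y yD.
  have /choice [a aE] : forall i, exists a, f a = \sum_(j < n) r i j *: y j.
    by move=> i; have /dom_ofP [e [a _ [fa _]]] := yD i; exists a.
  have [|x xE] := f_pure.2 _ _ _ Mr a; first by exists y => i; rewrite aE.
  exists (f \o x) => [j|i]; first by apply/dom_ofP; exists (g (x j)), (x j).
  by rewrite -aE -xE linear_sum; apply: eq_bigr => j _; rewrite linearZ.
Qed.

Lemma total_on_cover (T : Type) (F : set (set T)) m (x : 'I_m -> T) :
    F !=set0 -> total_on F subset -> (forall i, (\bigcup_(X in F) X) (x i)) ->
  exists2 X, F X & forall i, X (x i).
Proof.
move=> Fn Ftot; elim: m x => [|m IHm] x xF.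
  by have [X FX] := Fn; exists X => // -[].
have [X FX Xx] := IHm (fun i => x (fintype.lift ord0 i)) (fun i => xF _).
have [Y FY Yx] := xF ord0.
have [XY|YX] := Ftot _ _ FX FY.
  exists Y => // i; case: (unliftP ord0 i) => [j ->|-> //]; exact: XY.
by exists X => // i; case: (unliftP ord0 i) => [j -> //|->]; exact: YX.
Qed.

(** A system has finitely many rows, so that its right-hand sides lie in the
    domain of a single member of the chain. *)
Lemma partial_extension_bigcup (F : set (set (B * E))) :
  F !=set0 -> F `<=` partial_extension -> total_on F subset ->
  partial_extension (\bigcup_(X in F) X).
Proof.
move=> Fn FP Ftot; split.
- move=> r p q Up Uq; have [X [FX Xp Xq]] := total_on_cover2 Ftot Up Uq.
  by exists X => //; have [lin _ _ _] := FP _ FX; exact: lin.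
- by move=> a; have [X FX] := Fn; exists X => //; have [_ ext _ _] := FP _ FX.
- by move=> e [X FX]; have [_ _ func _] := FP _ FX; exact: func.
- move=> m n r Mr y yD.
  have /choice [e eE] : forall i, exists e,
      (\bigcup_(X in F) X) (\sum_(j < n) r i j *: y j, e).
    by move=> i; exact/dom_ofP.
  have [X FX Xy] := total_on_cover Fn Ftot eE.
  have [_ _ _ pureX] := FP _ FX.
  have [|x xD xE] := pureX _ _ _ Mr y.
    by move=> i; apply/dom_ofP; exists (e i).
  exists x => // j; have /dom_ofP [e' Xe'] := xD j.
  by apply/dom_ofP; exists e', X.
Qed.

Section Step.
Variables (G : set (B * E)) (S : {pred B}) (SP : submod_closed S).
Hypothesis GP : partial_extension G.
Variable k : {linear submodule SP -> E}.
Hypothesis kG : forall (s : submodule SP) e, G (submod_incl s, e) -> k s = e.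
Hypothesis S_mod : forall m n (r : 'M[R]_(m, n)) (s : 'I_m -> B),
  (forall i, s i \in S) ->
  (exists t : 'I_n -> B, forall i, \sum_(j < n) r i j *: t j - s i \in dom_of G) ->
  exists2 t : 'I_n -> B, forall i, \sum_(j < n) r i j *: t j - s i \in dom_of G &
    forall j, t j \in S.

Definition amalgam : set (B * E) :=
  [set (p.1 + submod_incl s, p.2 + k s) | p in G & s in setT].

Let G0 : G (0, 0).
Proof. by have [_ ext _ _] := GP; have := ext 0; rewrite !linear0. Qed.

Let sub_amalgam : G `<=` amalgam.
Proof.
by move=> [b e] Gbe; exists (b, e) => //; exists 0 => //; rewrite !linear0 !addr0.
Qed.

Let dom_amalgam b : b \in dom_of amalgam <->
  exists d (s : submodule SP), d \in dom_of G /\ b = d + submod_incl s.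
Proof.
split=> [/dom_ofP [e [[d e'] /= Gd [s _ [<- _]]]]|[d [s [/dom_ofP [e Ge] ->]]]].
  by exists d, s; split=> //; apply/dom_ofP; exists e'.
by apply/dom_ofP; exists (e + k s), (d, e) => //; exists s.
Qed.

(** The glued map is single-valued because the two maps agree where both are
    defined.  For purity of its domain D + S, let r y = d + s: a solution t in
    S of r t = s modulo D leaves r (y - t) in D, and purity of D replaces y - t
    by a solution in D. *)
Lemma amalgamP : [/\ partial_extension amalgam, G `<=` amalgam &
  forall s, s \in S -> s \in dom_of amalgam].
Proof.
have [lin ext func pureG] := GP; split=> //; last first.
  move=> s sS; apply/dom_amalgam; exists 0, (to_submod SP sS); split.
    by apply/dom_ofP; exists 0.
  by rewrite add0r.
split.
- move=> r _ _ [p Gp [s _ <-]] [q Gq [t _ <-]].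
  exists (r *: p + q); first exact: lin.
  exists (r *: s + t) => //; rewrite !linearP /=.
  by congr pair => /=; rewrite scalerDr addrACA.
- by move=> a; exact: sub_amalgam.
- move=> e [[d e'] /= Gd [s _ [ds <-]]].
  have dE : d = submod_incl (- s).
    by rewrite linearN; apply/eqP; rewrite -addr_eq0 ds.
  have := kG (s := - s) (e := e'); rewrite -dE linearN => /(_ Gd) <-.
  by rewrite addNr.
- move=> m n r Mr y yD.
  have /choice [d dP] : forall i, exists d, d \in dom_of G /\
      exists s : submodule SP, \sum_(j < n) r i j *: y j = d + submod_incl s.
    move=> i; have /dom_amalgam [d [s [dD yE]]] := yD i.
    by exists d; split=> //; exists s.
  have /choice [s sE] : forall i, exists s : submodule SP,
      \sum_(j < n) r i j *: y j = d i + submod_incl s by move=> i; exact: (dP i).2.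
  have [||t tD tS] := S_mod (r := r) (s := submod_incl \o s).
  + by move=> i; exact: submod_inclP.
  + by exists y => i; rewrite sE addrK; exact: (dP i).1.
  have domB u v : u \in dom_of G -> v \in dom_of G -> u - v \in dom_of G.
    move=> /dom_ofP [e Ge] /dom_ofP [e' Ge']; apply/dom_ofP; exists (e - e').
    by have := lin (-1) _ _ Ge' Ge; rewrite scaleN1r addrC.
  have [|x xD xE] := pureG _ _ _ Mr (fun j => y j - t j).
    move=> i; under eq_bigr do rewrite scalerBr.
    rewrite sumrB sE -addrA -opprB; apply: domB; last exact: tD.
    exact: (dP i).1.
  exists (fun j => x j + t j) => [j|i].
    by apply/dom_amalgam; exists (x j), (to_submod SP (tS j)).
  under eq_bigr do rewrite scalerDr; rewrite big_split /= xE -big_split /=.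
  by apply: eq_bigr => j _; rewrite scalerBr subrK.
Qed.
End Step.
End Fixed.

Variable P : lmodType R -> Prop.
Hypothesis P_sub : forall (A B : lmodType R) (f : {linear A -> B}),
  Mx_pure f -> P B -> P A.

(** A maximal partial extension is total, since the small hull of any [b] and the
    domain can be amalgamated. *)
Theorem extends_along_from_small (E : lmodType R) :
    (forall (A B : lmodType R) (f : {linear A -> B}),
      Mx_pure f -> P A -> P B -> small_module A -> small_module B ->
      extends_along E f) ->
  forall (A B : lmodType R) (f : {linear A -> B}),
    Mx_pure f -> P B -> extends_along E f.
Proof.
move=> Esmall A B f f_pure PB g.
have [G GP Gmax] := Zorn_subset (partial_extension_graph g f_pure)
  (@partial_extension_bigcup A B E f g).
have [lin ext func pureG] := GP.
have G0 : G (0, 0) by have := ext 0; rewrite !linear0.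
have functional b e e' : G (b, e) -> G (b, e') -> e = e'.
  move=> Ge Ge'; suff /func /eqP : G (0, e - e') by rewrite subr_eq0 => /eqP.
  have := lin (-1) _ _ Ge' Ge; congr G; congr pair => /=.
    by rewrite scaleN1r addNr.
  by rewrite scaleN1r addrC.
have total b : b \in dom_of G.
  have [S [SP [bS Ssmall SS]]] := hull (dom_of G) b.
  pose T : {pred B} := fun x => (x \in S) && (x \in dom_of G).
  have TP : submod_closed T.
    split=> [|r x y /andP [xS /dom_ofP [e Ge]] /andP [yS /dom_ofP [e' Ge']]].
      by apply/andP; split; [exact: SP.1|apply/dom_ofP; exists 0].
    apply/andP; split; first exact: SP.2.
    by apply/dom_ofP; exists (r *: e + e'); exact: (lin r (x, e) (y, e')).
  have TS (x : submodule TP) : submod_incl x \in S.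
    by have /andP [] := submod_inclP x.
  have TG (x : submodule TP) : exists e, G (submod_incl x, e).
    by have /andP [_ /dom_ofP] := submod_inclP x.
  have [h hG] := choice TG.
  have h_lin : linear h.
    move=> r x y; apply: (functional (r *: submod_incl x + submod_incl y)).
      by rewrite -linearP; exact: hG.
    by apply: (lin r (_, _) (_, _)); exact: hG.
  pose j x := to_submod SP (TS x).
  have j_lin : linear j by move=> r x y; apply: val_inj.
  (* Solving anywhere in [B] makes the hull pure in [B]. *)
  have S_pure : Mx_pure (submod_incl : {linear submodule SP -> B}).
    split=> [|m n r Mr a [y yE]]; first exact: submod_incl_inj.
    have [||t [_ tE] tS] := SS false false m n r (submod_incl \o a).
    - by move=> i; exact: submod_inclP.
    - by exists y.
    exists (fun l => to_submod SP (tS l)) => i; apply: submod_incl_inj.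
    rewrite -[RHS](tE i) linear_sum; apply: eq_bigr => l _.
    exact: linearZ.
  (* A system solvable in the hull is solvable in the domain, by purity of the
     latter, hence in their intersection. *)
  have j_pure : Mx_pure (linear_of j_lin).
    split=> [x y /(congr1 submod_incl) /= /val_inj //|m n r Mr a [y yE]].
    have aE i : \sum_(l < n) r i l *: submod_incl (y l) = submod_incl (a i).
      have := congr1 submod_incl (yE i); rewrite linear_sum /= => <-.
      exact: eq_bigr.
    have [|x xD xE] := pureG _ _ _ Mr (submod_incl \o y).
      by move=> i; rewrite aE; have /andP [] := submod_inclP (a i).
    have [||t [tD tE] tS] := SS true false m n r (submod_incl \o a).
    - by move=> i; exact: TS.
    - by exists x; split=> // i; rewrite xE aE.
    have tT l : t l \in T by apply/andP; split; [exact: tS|exact: tD].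
    exists (fun l => to_submod TP (tT l)) => i; apply: submod_incl_inj.
    rewrite -[RHS](tE i) linear_sum; apply: eq_bigr => l _.
    exact: linearZ.
  have PS := P_sub S_pure PB.
  have [|k kh] :=
    Esmall _ _ _ j_pure (P_sub j_pure PS) PS _ Ssmall (linear_of h_lin).
    apply: card_le_trans Ssmall; apply/embeds_card; exists j.
    exact: j_pure.1.
  have [| |HP GH HS] := @amalgamP A B E f g G S SP GP k.
  - move=> s e Gse.
    have sT : submod_incl s \in T.
      by apply/andP; split; [exact: submod_inclP|apply/dom_ofP; exists e].
    have := kh (to_submod TP sT); rewrite /= => kE.
    rewrite (_ : s = j (to_submod TP sT)); last exact: val_inj.
    by rewrite kE; exact: (functional _ _ _ (hG (to_submod TP sT)) Gse).
  - move=> m n r s sS [t tD].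
    have [|t' [_ t'E] t'S] := SS false true m n r s sS; first by exists t.
    by exists t'.
  have /dom_ofP [e He] := HS _ bS.
  by apply/dom_ofP; exists e; exact: (Gmax _ HP GH).
have /choice [h hG] : forall b, exists e, G (b, e) by move=> b; exact/dom_ofP.
have h_lin : linear h.
  move=> r x y; apply: (functional (r *: x + y)); first exact: hG.
  by apply: (lin r (_, _) (_, _)); exact: hG.
exists (linear_of h_lin) => a /=.
by apply: (functional (f a)); [exact: hG|exact: ext].
Qed.
End RelativePurity.

(** * Cotorsion modules and pure embeddings *)

Section Cotorsion.
Variable R : pzRingType.

Section Pushout.
Variables (A B F : lmodType R) (f : {linear A -> B}) (g : {linear A -> F}).

Definition image_pred : {pred B} := fun b => `[< exists a, b = f a >].
Lemma image_closed : submod_closed image_pred.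
Proof.
split=> [|r _ _ /asboolP [a ->] /asboolP [b ->]]; apply/asboolP.
  by exists 0; rewrite linear0.
by exists (r *: a + b); rewrite linearP.
Qed.

Definition antidiagonal : {pred (F * B)%type} :=
  fun p => `[< exists a, p = (g a, - f a) >].
Lemma antidiagonal_closed : submod_closed antidiagonal.
Proof.
split=> [|r _ _ /asboolP [a ->] /asboolP [b ->]]; apply/asboolP.
  by exists 0; rewrite !linear0.
by exists (r *: a + b); rewrite !linearP.
Qed.

Let cokernel := quotient_module image_closed.
Let pushout := quotient_module antidiagonal_closed.

Lemma pushout_glue a : quot_proj antidiagonal_closed (0, f a) =
  quot_proj antidiagonal_closed (g a, 0).
Proof.
apply/quot_projE/asboolP; exists (- a); rewrite !linearN opprK.
by congr pair; rewrite /= ?sub0r ?subr0.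
Qed.

Let cokernel_proj (y : B) : quot_proj image_closed y = 0 <-> exists x, f x = y.
Proof.
rewrite -(linear0 (quot_proj image_closed)) quot_projE subr0.
by split=> [/asboolP [a ->]|[a <-]]; [exists a|apply/asboolP; exists a].
Qed.

(** The pushout of [f] and [g] is an extension of the flat cokernel of [f] by
    [F]; a splitting of it restricts along [B] to an extension of [g]. *)
Lemma cotorsion_extends :
  pure_embedding f -> flat B -> cotorsion F ->
  exists h : {linear B -> F}, h \o f =1 g.
Proof.
move=> f_pure Bflat Fcot; pose pr := quot_proj antidiagonal_closed.
have Gflat : flat cokernel.
  apply: (flat_pure_quotient (g := quot_proj image_closed) f_pure) => // z.
  by have [y ->] := quot_proj_surj z; exists y.
have in_lin : linear (fun c : F => pr (c, 0)).
  by move=> r c d; rewrite -linearP; congr pr; congr pair; rewrite /= scaler0 addr0.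
have [|out outE] := @quotient_lift _ _ _ antidiagonal_closed cokernel
  (quot_proj image_closed \o snd).
  move=> _ /asboolP [a ->] /=; apply/cokernel_proj; exists (- a); exact: linearN.
have in_inj : injective (linear_of in_lin).
  move=> c d /quot_projE /asboolP [a [cd]]; rewrite subrr => /eqP.
  rewrite eq_sym oppr_eq0 => /eqP fa0.
  have a0 : a = 0 by apply: f_pure.1; rewrite fa0 linear0.
  by apply/eqP; rewrite -subr_eq0 cd a0 linear0.
have exact : range (linear_of in_lin) = [set x | out x = 0].
  apply/seteqP; split=> [_ [c _ <-]|x] /=; first by rewrite outE /= linear0.
  have [[c b] ->] := quot_proj_surj x; rewrite outE /= => /cokernel_proj [a <-].
  exists (c + g a) => //=; apply/quot_projE/asboolP; exists a.
  by congr pair; rewrite /= ?sub0r // addrAC subrr add0r.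
have surj : range out = setT.
  apply/seteqP; split=> // z _; have [y ->] := quot_proj_surj z.
  by exists (pr (0, y)) => //; rewrite outE.
have [phi [phi_in _]] := Fcot _ Gflat (Extension in_inj exact surj).
have h_lin : linear (fun b => (phi (pr (0, b))).1).
  move=> r x y; have -> : (0, r *: x + y) = r *: (0, x) + (0, y) :> (F * B)%type.
    by congr pair; rewrite /= scaler0 addr0.
  by rewrite /pr !linearP.
exists (linear_of h_lin) => a /=; rewrite /pr pushout_glue.
by have := phi_in (g a); rewrite /= => ->.
Qed.
End Pushout.

(** In an extension of a flat [G] by [F] the middle module is flat and contains
    [F] purely, so that the identity of [F] extends to a retraction, which
    splits the extension. *)
Lemma cotorsion_from_extends (F : lmodType R) : flat F ->
  (forall (A B : lmodType R) (f : {linear A -> B}),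
     pure_embedding f -> flat B -> extends_along F f) ->
  cotorsion F.
Proof.
move=> Fflat ext G Gflat [X j q j_inj j_exact q_surj].
have q_surj' z : exists x, q x = z.
  have [x _ <-] : range q z by rewrite q_surj.
  by exists x.
have jq y : q y = 0 <-> exists x, j x = y.
  have -> : (q y = 0) = range j y by rewrite j_exact.
  by split=> [[x _ <-]|[x <-]]; exists x.
have [rho rhoj] := ext _ _ j (flat_cokernel_pure j_inj q_surj' jq Gflat)
  (flat_extension j_inj q_surj' jq Gflat Fflat) (idfun : {linear F -> F}).
have phi_lin : linear (fun x => (rho x, q x) : (F * G)%type).
  by move=> r x y; rewrite !linearP.
exists (linear_of phi_lin); split=> x //=.
congr pair; first exact: rhoj.
by apply/jq; exists x.
Qed.
End Cotorsion.

(** * Injectivity tested on small embeddings *)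

Lemma RD_embeddingP (R : pzRingType) (A B : lmodType R) (f : {linear A -> B}) :
  RD_embedding f <-> Mx_pure (fun m n _ => m = 1%N /\ n = 1%N) f.
Proof.
split=> [] [f_inj fpure]; split=> //.
  move=> m n r [m1 n1] a [y yE]; subst m n.
  have : (range f `&` range (fun b : B => r 0 0 *: b)) (f (a 0)).
    by split; [exists (a 0)|exists (y 0) => //; rewrite -yE big_ord1].
  rewrite fpure => -[_ [x _ <-]]; rewrite -linearZ => /f_inj xE.
  by exists (fun=> x) => i; rewrite big_ord1 !ord1.
move=> r; apply/seteqP; split=> [_ [[a _ <-] [b _ bE]]|_ [_ [a _ <-] <-]].
  have [||x xE] := fpure 1%N 1%N (const_mx r) _ (fun=> a) => //.
    by exists (fun=> b) => i; rewrite big_ord1 mxE.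
  exists (f (x 0)); first by exists (x 0).
  by rewrite -linearZ -(xE 0) big_ord1 mxE.
by split; [exists (r *: a) => //; rewrite linearZ|exists (f a)].
Qed.

Lemma Mx_pureT (R : pzRingType) (A B : lmodType R) (f : {linear A -> B}) :
  pure_embedding f <-> Mx_pure (fun _ _ _ => True) f.
Proof.
by split=> [] [f_inj fpure]; split=> // m n r; [move=> _|]; move=> a; exact: fpure.
Qed.

Theorem corollary4p10 (R : pzRingType) :
  (forall E : lmodType R,
     injective_module E <->
     (forall (A B : lmodType R) (f : {linear A -> B}),
        injective f -> small_module A -> small_module B ->
        forall g : {linear A -> E},
          exists h : {linear B -> E}, h \o f =1 g)) /\
  (forall E : lmodType R,
     RD_injective E <->
     (forall (A B : lmodType R) (f : {linear A -> B}),
        RD_embedding f -> small_module A -> small_module B ->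
        forall g : {linear A -> E},
          exists h : {linear B -> E}, h \o f =1 g)) /\
  (forall E : lmodType R,
     pure_injective E <->
     (forall (A B : lmodType R) (f : {linear A -> B}),
        pure_embedding f -> small_module A -> small_module B ->
        forall g : {linear A -> E},
          exists h : {linear B -> E}, h \o f =1 g)) /\
  (forall F : lmodType R, flat F ->
     (cotorsion F <->
     (forall (A B : lmodType R) (f : {linear A -> B}),
        pure_embedding f -> flat A -> flat B ->
        small_module A -> small_module B ->
        forall g : {linear A -> F},
          exists h : {linear B -> F}, h \o f =1 g))) /\
  (* [i] is the inclusion of the right module R into its injective envelope *)
  (forall (ER : lmodType R^c)
          (i : {linear regular_right R -> ER}),
     injective_envelope i ->
     forall T : lmodType R, s_torsion i T ->
     (s_torsion_pure_injective i T <->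
     (forall (A B : lmodType R) (f : {linear A -> B}),
        pure_embedding f -> s_torsion i A -> s_torsion i B ->
        small_module A -> small_module B ->
        forall g : {linear A -> T},
          exists h : {linear B -> T}, h \o f =1 g))).
Proof.
split; [|split; [|split; [|split]]].
(* No matrix is tested: every embedding counts as pure. *)
- move=> E; split=> [inj A B f f_inj _ _|small A B f f_inj].
    exact: inj.
  apply: (@extends_along_from_small _ (fun _ _ _ => False) (fun=> True)) => //.
  by move=> A' B' f' [f'_inj _] _ _ ? ?; exact: small.
- move=> E; split=> [inj A B f f_RD _ _|small A B f /RD_embeddingP f_RD].
    exact: inj.
  apply: (@extends_along_from_small _ _ (fun=> True) _ _ _ _ _ _ f_RD) => //.
  by move=> A' B' f' /RD_embeddingP f'_RD _ _ ? ?; exact: small.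
- move=> E; split=> [inj A B f f_pure _ _|small A B f /Mx_pureT f_pure].
    exact: inj.
  apply: (@extends_along_from_small _ _ (fun=> True) _ _ _ _ _ _ f_pure) => //.
  by move=> A' B' f' /Mx_pureT f'_pure _ _ ? ?; exact: small.
- move=> F Fflat; split=> [Fcot A B f f_pure _ Bflat _ _ g|small].
    exact: cotorsion_extends.
  apply: cotorsion_from_extends => // A B f /Mx_pureT f_pure Bflat.
  apply: (@extends_along_from_small _ _ (@flat R) _ _ _ _ _ _ f_pure) => //.
    by move=> A' B' f' /Mx_pureT; exact: flat_pure_sub.
  by move=> A' B' f' /Mx_pureT f'_pure ? ? ? ?; exact: small.
- move=> ER i _ T Ttor; split=> [inj A B f f_pure At Bt _ _|small A B f At Bt].
    exact: inj.
  move=> /Mx_pureT f_pure.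
  apply: (@extends_along_from_small _ _ (@s_torsion R ER i) _ _ _ _ _ _ f_pure) => //.
    by move=> A' B' f' /Mx_pureT; exact: s_torsion_pure_sub.
  by move=> A' B' f' /Mx_pureT f'_pure ? ? ? ?; exact: small.
Qed.
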